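(* Let $\hbar,k_B,m,\theta_D>0$. Let $\omega_D=k_B\theta_D/\hbar$ and let $g(\omega)=A\omega^2$ for $0<\omega\le\omega_D$, where $A>0$ is fixed by $\int_0^{\omega_D}g(\omega)\,d\omega=3$ (the Debye model with Debye temperature $\theta_D$). For $T>0$, with $\beta=1/(k_BT)$, let $$\langle u^2\rangle_0(T)=\int_0^{\omega_D}\frac{\hbar}{2m\omega}\bigl(1-e^{-\beta\hbar\omega}\bigr)\,g(\omega)\,d\omega,$$ $$\langle u^2\rangle_T(T)=\int_0^{\omega_D}\sum_{n=1}^{\infty}\bigl(1-e^{-\beta\hbar\omega}\bigr)e^{-\beta n\hbar\omega}\Bigl(n+\tfrac12\Bigr)\frac{\hbar}{m\omega}\,g(\omega)\,d\omega .$$ Let $T_0$ be the characteristic temperature, i.e. the temperature $T_0>0$ such that $\langle u^2\rangle_0(T_0)=\langle u^2\rangle_T(T_0)$ and $\langle u^2\rangle_0(T)>\langle u^2\rangle_T(T)$ for all $0<T<T_0$. Then $$T_0=\frac{\theta_D}{\zeta},\qquad \zeta\approx 2.99345...,$$ where $\zeta$ is a numerical constant (independent of $\hbar,k_B,m,\theta_D$).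
   Context: Physical setting: a one-component crystal of atoms of mass $m$, all with the same bonding geometry, treated in the harmonic approximation at temperature $T$; $\hbar$ is the reduced Planck constant and $k_B$ the Boltzmann constant. The function $g$ is the per-atom vibrational density of states, $\langle u^2\rangle_0$ is the atomic mean square displacement due to zero-point vibration (ground states of all modes), and $\langle u^2\rangle_T$ is the mean square displacement due to all excited vibrational states; the subscript $T$ is only a label for the excited (thermal) part. The value of $\zeta$ is a numerical approximation: with $x=\hbar\omega/(k_BT)$, the equality $\langle u^2\rangle_0=\langle u^2\rangle_T$ becomes $\int_0^{\theta_D/T}\frac12(1-e^{-x})x\,dx=\int_0^{\theta_D/T}\frac{3e^x-1}{2e^x(e^x-1)}x\,dx$, and at $\theta_D/T=2.99345$ the two sides are reported to differ by less than $5\times10^{-5}$. *)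

(* Defs.v *)
From Stdlib Require Export Reals.
From Coquelicot Require Export Coquelicot.
Open Scope R_scope.

Definition beta (kB T : R) : R := / (kB * T).

Definition debye_frequency (hbar kB thetaD : R) : R := kB * thetaD / hbar.

(* The values of [g] outside (0, omegaD] are left free. *)
Definition is_debye_dos (omegaD : R) (g : R -> R) : Prop :=
  exists A : R,
    0 < A /\
    (forall w, 0 < w <= omegaD -> g w = A * w ^ 2) /\
    is_RInt g 0 omegaD 3.

(* Both integrands below contain a division by [w]; its totalised value at
   [w = 0] affects the integrand at that single point only, hence not the
   integral. *)
Definition msd_zero_point (hbar kB m omegaD : R) (g : R -> R) (T : R) : R :=
  RInt (fun w => hbar / (2 * m * w) * (1 - exp (- (beta kB T * hbar * w))) * g w)
       0 omegaD.

(* [Series] starts at index 0, so [S k] stands for the level n = 1, 2, ... *)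
Definition msd_thermal (hbar kB m omegaD : R) (g : R -> R) (T : R) : R :=
  RInt (fun w =>
          Series (fun k =>
            (1 - exp (- (beta kB T * hbar * w)))
            * exp (- (beta kB T * INR (S k) * hbar * w))
            * (INR (S k) + 1 / 2) * (hbar / (m * w))) * g w)
       0 omegaD.

Definition is_characteristic_temperature
    (hbar kB m omegaD : R) (g : R -> R) (T0 : R) : Prop :=
  0 < T0 /\
  msd_zero_point hbar kB m omegaD g T0 = msd_thermal hbar kB m omegaD g T0 /\
  (forall T, 0 < T < T0 ->
     msd_zero_point hbar kB m omegaD g T > msd_thermal hbar kB m omegaD g T).

(* The two sides of the equality of the displacements in the dimensionless
   variable x = hbar * w / (kB * T), as functions of z = thetaD / T and up to a
   common positive factor. *)
Definition reduced_zero_point (z : R) : R :=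
  RInt (fun x => 1 / 2 * (1 - exp (- x)) * x) 0 z.

Definition reduced_thermal (z : R) : R :=
  RInt (fun x => (3 * exp x - 1) / (2 * exp x * (exp x - 1)) * x) 0 z.

(* Main.v *)
(* Summing the series over the excited states and substituting
   x = hbar w / (kB T), the difference of the two displacements is a positive
   multiple of gap (thetaD / T), where
     gap z = int_0^z (x / 2 - x exp (- x) - x / (exp x - 1)) dx.
   The integrand divided by x is increasing, so gap, which vanishes at 0, first
   decreases and then increases: it has at most one positive zero, after which
   it is positive.

   The zero is located by writing
     x / (exp x - 1)
     = sum_(1 <= k <= N) x exp (- k x) + exp (- N x) x / (exp x - 1)
   and enclosing the last quotient between 1 - x / 2 and 1 - x / 2 + x^2 / 12.
   This encloses gap between closed forms at distance less than 1 / (6 N^3),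
   and N = 30 suffices for gap 2.9934 < 0 < gap 2.99345 < 5 / 10^5. *)

Require Import Defs.
From Stdlib Require Import Reals Factorial Lra Lia.
From Coquelicot Require Import Coquelicot.
Open Scope R_scope.

(** * Two tools from calculus *)

(** Applied repeatedly, this reduces an inequality between functions that agree at 0 to several
    orders to the sign of the last derivative. *)
Lemma nonneg_of_derive_nonneg (f f' : R -> R) :
  f 0 = 0 ->
  (forall x, 0 <= x -> is_derive f x (f' x)) ->
  (forall x, 0 <= x -> 0 <= f' x) ->
  forall x, 0 <= x -> 0 <= f x.
Proof.
intros f0 df f'_ge0 x x_ge0.
destruct (Rle_lt_or_eq_dec 0 x x_ge0) as [x_gt0 | <-]; [| lra].
destruct (MVT_cor2 f f' 0 x x_gt0) as [c [eq_c c_in]].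
{ intros c Hc; apply is_derive_Reals, df; lra. }
assert (0 <= f' c * (x - 0)) by (apply Rmult_le_pos; [apply f'_ge0 |]; lra).
lra.
Qed.

(** Comparing on the open interval only keeps out the point 0, where [g] is free and the integrands
    contain a division by 0. *)
Lemma RInt_eq_on (f g : R -> R) (a b : R) :
  a <= b -> (forall x, a < x < b -> f x = g x) -> RInt f a b = RInt g a b.
Proof.
intros le_ab eq_fg; apply RInt_ext; intros x.
now rewrite Rmin_left, Rmax_right; [apply eq_fg | |].
Qed.

(** * The function x / (exp x - 1) *)

(** The value 1 at 0 is the continuous extension, so that its inverse [planck] is continuous on the
    whole line and [gap] is differentiable at 0 too. *)
Definition expm1_ratio (x : R) : R :=
  if Req_EM_T x 0 then 1 else (exp x - 1) / x.

Definition planck (x : R) : R := / expm1_ratio x.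

Lemma planck_0 : planck 0 = 1.
Proof.
unfold planck, expm1_ratio; destruct (Req_EM_T 0 0); [apply Rinv_1 | easy].
Qed.

Lemma expm1_pos x : 0 < x -> 0 < exp x - 1.
Proof. intros x_gt0; pose proof (exp_ineq1 x); lra. Qed.

Lemma expm1_neq0 x : x <> 0 -> exp x - 1 <> 0.
Proof.
intros x_neq0 E; apply x_neq0, exp_inv; rewrite exp_0; lra.
Qed.

Lemma planck_neq0 x : x <> 0 -> planck x = x / (exp x - 1).
Proof.
intros x_neq0; unfold planck, expm1_ratio.
destruct (Req_EM_T x 0) as [| _]; [easy |].
field; split; [apply expm1_neq0 |]; easy.
Qed.

Lemma planck_mul_expm1 x : planck x * (exp x - 1) = x.
Proof.
destruct (Req_dec x 0) as [-> | x_neq0].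
- rewrite exp_0; ring.
- rewrite planck_neq0 by easy; field; apply expm1_neq0; easy.
Qed.

Lemma expm1_ratio_continuity : continuity expm1_ratio.
Proof.
intros x; destruct (Req_dec x 0) as [-> | x_neq0].
(* Continuity at 0 is the differentiability of [exp] at 0: the ratio is its difference quotient
   there. *)
- intros eps eps_gt0.
  destruct (derivable_pt_lim_exp_0 eps eps_gt0) as [d Hd].
  exists d; split; [apply cond_pos |].
  intros y [[_ y_neq0] y_near].
  change (Rabs (y - 0) < d) in y_near.
  change (Rabs (expm1_ratio y - expm1_ratio 0) < eps).
  unfold expm1_ratio.
  destruct (Req_EM_T y 0) as [E | ny]; [now destruct y_neq0 |].
  destruct (Req_EM_T 0 0) as [_ | []]; [| easy].
  specialize (Hd y ny); rewrite Rplus_0_l, exp_0 in Hd.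
  apply Hd; now rewrite Rminus_0_r in y_near.
- apply continuity_pt_ext_loc with (fun y => (exp y - 1) / y).
  + exists (mkposreal _ (Rabs_pos_lt x x_neq0)); intros y Hy.
    change (Rabs (y - x) < Rabs x) in Hy.
    unfold expm1_ratio; destruct (Req_EM_T y 0) as [-> |]; [| easy].
    rewrite Rminus_0_l, Rabs_Ropp in Hy; lra.
  + apply continuity_pt_filterlim.
    apply (ex_derive_continuous (fun y => (exp y - 1) / y)).
    auto_derive; easy.
Qed.

Lemma planck_continuous x : continuous planck x.
Proof.
apply continuity_pt_filterlim, continuity_pt_inv.
- apply expm1_ratio_continuity.
- unfold expm1_ratio; destruct (Req_EM_T x 0) as [| x_neq0]; [lra |].
  apply Rmult_integral_contrapositive_currified.
  + now apply expm1_neq0.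
  + now apply Rinv_neq_0_compat.
Qed.

(** After multiplication by [exp x - 1], the difference of the sides and its first derivative vanish
    at 0, and the second derivative is [x / 2 * exp x]. *)
Lemma planck_ge x : 0 <= x -> 1 - x / 2 <= planck x.
Proof.
intros x_ge0.
destruct (Rle_lt_or_eq_dec 0 x x_ge0) as [x_gt0 | <-]; [| rewrite planck_0; lra].
apply Rmult_le_reg_r with (exp x - 1); [now apply expm1_pos |].
rewrite planck_mul_expm1; apply Rminus_le_0.
clear x_gt0; revert x x_ge0.
apply nonneg_of_derive_nonneg with (fun x => 1 / 2 + (x / 2 - 1 / 2) * exp x).
- rewrite exp_0; lra.
- intros x _; auto_derive; [easy | field].
- apply nonneg_of_derive_nonneg with (fun x => x / 2 * exp x).
  + rewrite exp_0; lra.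
  + intros x _; auto_derive; [easy | field].
  + intros x x_ge0; apply Rmult_le_pos; [lra | left; apply exp_pos].
Qed.

(** Same method, with one more differentiation: the third derivative is [x ^ 2 / 12 * exp x]. *)
Lemma planck_le x : 0 <= x -> planck x <= 1 - x / 2 + x ^ 2 / 12.
Proof.
intros x_ge0.
destruct (Rle_lt_or_eq_dec 0 x x_ge0) as [x_gt0 | <-]; [| rewrite planck_0; lra].
apply Rmult_le_reg_r with (exp x - 1); [now apply expm1_pos |].
rewrite planck_mul_expm1; apply Rminus_le_0.
clear x_gt0; revert x x_ge0.
apply nonneg_of_derive_nonneg
  with (fun x => (1 / 2 - x / 3 + x ^ 2 / 12) * exp x - 1 / 2 - x / 6).
- rewrite exp_0; lra.
- intros x _; auto_derive; [easy | field].
- apply nonneg_of_derive_nonneg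
    with (fun x => (1 / 6 - x / 6 + x ^ 2 / 12) * exp x - 1 / 6).
  + rewrite exp_0; lra.
  + intros x _; auto_derive; [easy | field].
  + apply nonneg_of_derive_nonneg with (fun x => x ^ 2 / 12 * exp x).
    * rewrite exp_0; lra.
    * intros x _; auto_derive; [easy | field].
    * intros x _; apply Rmult_le_pos; [| left; apply exp_pos].
      pose proof (pow2_ge_0 x); lra.
Qed.

Lemma planck_geometric n x :
  planck x =
  sum_n (fun k => x * exp (- (INR (S k) * x))) n
  + exp (- (INR (S n) * x)) * planck x.
Proof.
(* This is [planck x * (exp x - 1) = x] multiplied by [exp (- (y + x))]; it is iterated at y = 0, x,
   2 x, and so on. *)
assert (step : forall y, exp (- y) * planck x
    = x * exp (- (y + x)) + exp (- (y + x)) * planck x).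
{ intros y.
  replace (exp (- y)) with (exp (- (y + x)) * exp x)
    by (rewrite <- exp_plus; f_equal; ring).
  replace (x * exp (- (y + x)))
    with (planck x * (exp x - 1) * exp (- (y + x)))
    by now rewrite planck_mul_expm1.
  ring. }
induction n as [| n IHn].
- rewrite sum_O, Rmult_1_l; specialize (step 0).
  now rewrite Ropp_0, exp_0, Rmult_1_l, Rplus_0_l in step.
- rewrite IHn at 1; rewrite step, sum_Sn.
  replace (INR (S n) * x + x) with (INR (S (S n)) * x)
    by (rewrite (S_INR (S n)); ring).
  symmetry; apply Rplus_assoc.
Qed.

(** * The difference of the two displacements *)

Definition gap_density (x : R) : R := x / 2 - x * exp (- x) - planck x.

Definition gap (z : R) : R := RInt gap_density 0 z.

Lemma gap_density_continuous x : continuous gap_density x.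
Proof.
apply (continuous_minus (fun x => x / 2 - x * exp (- x)) planck).
- apply (ex_derive_continuous (fun x => x / 2 - x * exp (- x))).
  now auto_derive.
- apply planck_continuous.
Qed.

Lemma gap_0 : gap 0 = 0.
Proof. apply (RInt_point (V := R_CompleteNormedModule)). Qed.

Lemma gap_derive z : is_derive gap z (gap_density z).
Proof.
apply (is_derive_RInt gap_density gap 0 z).
- apply filter_forall; intros y; apply (RInt_correct gap_density).
  apply (ex_RInt_continuous gap_density); intros; apply gap_density_continuous.
- apply gap_density_continuous.
Qed.

Lemma zero_point_ex_RInt z :
  ex_RInt (fun x => 1 / 2 * (1 - exp (- x)) * x) 0 z.
Proof.
apply (ex_RInt_continuous (V := R_CompleteNormedModule)); intros x _.
apply (ex_derive_continuous (fun x => 1 / 2 * (1 - exp (- x)) * x)).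
now auto_derive.
Qed.

(** Partial fractions in [exp x]. The left side is continuous at 0, which gives the integrability of
    the right side. *)
Lemma thermal_density_eq x : 0 < x ->
  planck x + x * exp (- x) / 2
  = (3 * exp x - 1) / (2 * exp x * (exp x - 1)) * x.
Proof.
intros x_gt0; rewrite planck_neq0, exp_Ropp by lra.
pose proof (expm1_pos x x_gt0); pose proof (exp_pos x).
field; lra.
Qed.

Lemma thermal_ex_RInt z : 0 <= z ->
  ex_RInt (fun x => (3 * exp x - 1) / (2 * exp x * (exp x - 1)) * x) 0 z.
Proof.
intros z_ge0.
apply ex_RInt_ext with (fun x => planck x + x * exp (- x) / 2).
- intros x; rewrite Rmin_left by easy; intros Hx.
  now apply thermal_density_eq.
- apply (ex_RInt_continuous (V := R_CompleteNormedModule)); intros x _.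
  apply (continuous_plus planck (fun x => x * exp (- x) / 2)).
  + apply planck_continuous.
  + apply (ex_derive_continuous (fun x => x * exp (- x) / 2)).
    now auto_derive.
Qed.

Lemma gap_eq z : 0 <= z -> reduced_zero_point z - reduced_thermal z = gap z.
Proof.
intros z_ge0; unfold reduced_zero_point, reduced_thermal, gap.
rewrite <- (RInt_minus (V := R_CompleteNormedModule))
  by (apply zero_point_ex_RInt || now apply thermal_ex_RInt).
apply RInt_eq_on; [easy | intros x [x_gt0 _]].
rewrite <- thermal_density_eq by easy.
unfold gap_density, minus, plus, opp; simpl; field.
Qed.

(** By the mean value theorem [gap_density] vanishes at some x in (0, z1), and [gap z2] is [z2 - z1]
    times its value at some y in (z1, z2). As [gap_density t / t] is increasing and x < y, that
    value is positive. *)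
Lemma gap_pos_after_zero z1 z2 : 0 < z1 -> gap z1 = 0 -> z1 < z2 -> 0 < gap z2.
Proof.
intros z1_gt0 gap_z1 lt_z12.
assert (dgap : forall c, derivable_pt_lim gap c (gap_density c))
  by (intros c; apply is_derive_Reals, gap_derive).
destruct (MVT_cor2 gap gap_density 0 z1) as [x [eq_x Hx]]; [easy .. |].
destruct (MVT_cor2 gap gap_density z1 z2) as [y [eq_y Hy]]; [easy .. |].
rewrite gap_0, gap_z1 in eq_x; rewrite gap_z1, Rminus_0_r in eq_y.
rewrite eq_y; apply Rmult_lt_0_compat; [| lra].
assert (factor : forall t, 0 < t ->
    gap_density t = t * (1 / 2 - exp (- t) - / (exp t - 1))).
{ intros t t_gt0; unfold gap_density; rewrite planck_neq0 by lra.
  pose proof (expm1_pos t t_gt0); field; lra. }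
assert (gap_density x = 0) as hx.
{ destruct (Rmult_integral (gap_density x) (z1 - 0)); lra. }
rewrite factor in hx by lra; rewrite factor by lra.
apply Rmult_lt_0_compat; [lra |].
destruct (Rmult_integral _ _ hx) as [| hx']; [lra |].
assert (exp (- y) < exp (- x)) by (apply exp_increasing; lra).
assert (exp x < exp y) by (apply exp_increasing; lra).
assert (/ (exp y - 1) < / (exp x - 1)).
{ apply Rinv_lt_contravar; [| lra].
  apply Rmult_lt_0_compat; apply expm1_pos; lra. }
lra.
Qed.

(** * Numerical enclosure of the gap *)

(* The integral of exp (- N t) (1 - t / 2 + c2 t^2) over [0, x]. *)
Definition remainder_integral (N c2 x : R) : R :=
  (* Matching coefficients makes [exp (- (N * x)) * (a + b * x + c * x ^ 2)] an antiderivative; its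
     value at 0 is [a]. *)
  let c := - c2 / N in
  let b := (2 * c + 1 / 2) / N in
  let a := (b - 1) / N in
  exp (- (N * x)) * (a + b * x + c * x ^ 2) - a.

(* The sum starts at index 0, so [n] stands for N = n + 1 geometric terms. *)
Definition gap_approx (n : nat) (c2 x : R) : R :=
  x ^ 2 / 4 - (1 - (1 + x) * exp (- x))
  - sum_n (fun k => (1 - exp (- (INR (S k) * x)) * (1 + INR (S k) * x))
                    / INR (S k) ^ 2) n
  - remainder_integral (INR (S n)) c2 x.

Lemma gap_approx_0 n c2 : gap_approx n c2 0 = 0.
Proof.
unfold gap_approx, remainder_integral.
rewrite (sum_n_ext _ (fun _ => 0)).
- rewrite sum_n_const; cbv zeta; rewrite !Rmult_0_r, Ropp_0, exp_0; field.
  apply not_0_INR; lia.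
- assert (E : forall N, N <> 0 ->
      (1 - exp (- (N * 0)) * (1 + N * 0)) / N ^ 2 = 0).
  { intros N N_neq0; rewrite Rmult_0_r, Ropp_0, exp_0; field; easy. }
  intros k; apply E, not_0_INR; lia.
Qed.

(** Each summand of [gap_approx] is an antiderivative of [x * exp (- (k * x))] with k = 1, ..., n +
    1. By [planck_geometric] these terms cancel, so the error has the sign of [planck] minus its
    quadratic approximation. *)
Lemma gap_approx_derive n c2 x :
  is_derive (gap_approx n c2) x
    (gap_density x
     + exp (- (INR (S n) * x)) * (planck x - (1 - x / 2 + c2 * x ^ 2))).
Proof.
assert (N_neq0 : forall k, INR (S k) <> 0) by (intros; apply not_0_INR; lia).
replace (gap_density x + _) with
  (x / 2 - x * exp (- x)
   - sum_n (fun k => x * exp (- (INR (S k) * x))) n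
   - exp (- (INR (S n) * x)) * (1 - x / 2 + c2 * x ^ 2)).
2:{ unfold gap_density; rewrite (planck_geometric n x) at 1; ring. }
unfold gap_approx.
apply (is_derive_minus (V := R_NormedModule)).
- apply (is_derive_minus (V := R_NormedModule)).
  + auto_derive; [easy | field].
  + apply (is_derive_sum_n (V := R_NormedModule)
      (fun k x => (1 - exp (- (INR (S k) * x)) * (1 + INR (S k) * x))
                    / INR (S k) ^ 2)).
    intros k _; specialize (N_neq0 k).
    generalize dependent (INR (S k)); intros N N_neq0.
    auto_derive; [easy | field; easy].
- specialize (N_neq0 n); generalize dependent (INR (S n)); intros N N_neq0.
  unfold remainder_integral; auto_derive; [easy | field; easy].
Qed.

Lemma gap_le_approx n z : 0 <= z -> gap z <= gap_approx n 0 z.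
Proof.
intros z_ge0; apply Rminus_le_0; revert z z_ge0.
apply nonneg_of_derive_nonneg with
  (fun x => exp (- (INR (S n) * x)) * (planck x - (1 - x / 2))).
- rewrite gap_0, gap_approx_0; ring.
- intros x _.
  replace (_ * _) with
    (minus (gap_density x
            + exp (- (INR (S n) * x)) * (planck x - (1 - x / 2 + 0 * x ^ 2)))
       (gap_density x)) by (unfold minus, plus, opp; simpl; ring).
  apply (is_derive_minus (V := R_NormedModule)).
  + apply gap_approx_derive.
  + apply gap_derive.
- intros x x_ge0; apply Rmult_le_pos; [left; apply exp_pos |].
  pose proof (planck_ge x x_ge0); lra.
Qed.

Lemma gap_ge_approx n z : 0 <= z -> gap_approx n (1 / 12) z <= gap z.
Proof.
intros z_ge0; apply Rminus_le_0; revert z z_ge0.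
apply nonneg_of_derive_nonneg with
  (fun x => exp (- (INR (S n) * x)) * (1 - x / 2 + x ^ 2 / 12 - planck x)).
- rewrite gap_0, gap_approx_0; ring.
- intros x _.
  replace (_ * _) with
    (minus (gap_density x)
       (gap_density x
        + exp (- (INR (S n) * x)) * (planck x - (1 - x / 2 + 1 / 12 * x ^ 2))))
    by (unfold minus, plus, opp; simpl; field).
  apply (is_derive_minus (V := R_NormedModule)).
  + apply gap_derive.
  + apply gap_approx_derive.
- intros x x_ge0; apply Rmult_le_pos; [left; apply exp_pos |].
  pose proof (planck_le x x_ge0); lra.
Qed.

(** * Taylor enclosure of exp (- x) *)

Definition exp_neg_taylor (n : nat) (x : R) : R :=
  sum_n (fun k => (- x) ^ k / INR (fact k)) n.

Lemma exp_neg_taylor_derive n x :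
  is_derive (exp_neg_taylor (S n)) x (- exp_neg_taylor n x).
Proof.
unfold exp_neg_taylor; induction n as [| n IHn].
- apply is_derive_ext with (fun x => 1 - x).
  + intros t; rewrite sum_Sn, sum_O; unfold plus; simpl; field.
  + rewrite sum_O; simpl; auto_derive; [easy | field].
- apply is_derive_ext with (fun x =>
    plus (sum_n (fun k => (- x) ^ k / INR (fact k)) (S n))
      ((- x) ^ (S (S n)) / INR (fact (S (S n))))).
  + intros t; now rewrite (sum_Sn _ (S n)).
  + rewrite sum_Sn.
    replace (- _) with
      (plus (- sum_n (fun k => (- x) ^ k / INR (fact k)) n)
         (- ((- x) ^ S n / INR (fact (S n))))) by (unfold plus; simpl; ring).
    apply (is_derive_plus (V := R_NormedModule)); [easy |].
    rewrite (fact_simpl (S n)), mult_INR.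
    pose proof (INR_fact_neq_0 (S n)) as fact_neq0.
    assert (INR (S (S n)) <> 0) by (apply not_0_INR; lia).
    generalize dependent (INR (fact (S n))); intros f f_neq0.
    auto_derive; [easy |].
    change (match n with 0%nat => 1 | S _ => INR n + 1 end) with (INR (S n)).
    rewrite !S_INR in *; simpl; field; easy.
Qed.

(** The remainder of order n + 1 vanishes at 0 and its derivative is minus the remainder of order n;
    the alternating sign turns this derivative into the induction hypothesis. *)
Lemma exp_neg_taylor_alternating n x : 0 <= x ->
  0 <= (-1) ^ S n * (exp (- x) - exp_neg_taylor n x).
Proof.
revert x; induction n as [| n IHn].
- intros x x_ge0; unfold exp_neg_taylor; rewrite sum_O; simpl.
  assert (exp (- x) <= exp 0).
  { destruct x_ge0 as [x_gt0 | <-]; [left; apply exp_increasing; lra |].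
    rewrite Ropp_0; lra. }
  rewrite exp_0 in *; lra.
- apply nonneg_of_derive_nonneg
    with (fun x => (-1) ^ S n * (exp (- x) - exp_neg_taylor n x)); [| | easy].
  + replace (exp_neg_taylor (S n) 0) with 1.
    * rewrite Ropp_0, exp_0; ring.
    * unfold exp_neg_taylor; clear IHn; induction n as [| n IHn].
      -- rewrite sum_Sn, sum_O; unfold plus; simpl; field.
      -- rewrite sum_Sn, <- IHn, Ropp_0, pow_i by lia.
         unfold Rdiv; rewrite Rmult_0_l; symmetry; apply Rplus_0_r.
  + intros x _.
    replace (_ * _) with
      ((-1) ^ S (S n) * minus (- exp (- x)) (- exp_neg_taylor n x))
      by (unfold minus, plus, opp; simpl; ring).
    apply (is_derive_scal (fun x => exp (- x) - exp_neg_taylor (S n) x)).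
    apply (is_derive_minus (V := R_NormedModule)).
    * auto_derive; [easy | ring].
    * apply exp_neg_taylor_derive.
Qed.

Lemma exp_neg_taylor_bounds x : 0 <= x ->
  1 - x + x ^ 2 / 2 - x ^ 3 / 6 + x ^ 4 / 24 - x ^ 5 / 120 + x ^ 6 / 720
    - x ^ 7 / 5040
  <= exp (- x) <=
  1 - x + x ^ 2 / 2 - x ^ 3 / 6 + x ^ 4 / 24 - x ^ 5 / 120 + x ^ 6 / 720.
Proof.
intros x_ge0.
pose proof (exp_neg_taylor_alternating 6 x x_ge0) as upper.
pose proof (exp_neg_taylor_alternating 7 x x_ge0) as lower.
unfold exp_neg_taylor in *; rewrite !sum_Sn, sum_O in *.
repeat change (@plus _ ?a ?b) with (Rplus a b) in *.
rewrite !INR_IZR_INZ in *; simpl in *; lra.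
Qed.

Lemma exp_neg_mult_INR k x : exp (- (INR k * x)) = exp (- x) ^ k.
Proof.
induction k as [| k IHk].
- simpl; rewrite Rmult_0_l, Ropp_0; apply exp_0.
- rewrite S_INR; simpl; rewrite <- IHk, <- exp_plus; f_equal; ring.
Qed.

(* The argument is scaled by 1/16 to make the Taylor bounds sharp. *)
Lemma exp_neg_bounds y l u : 0 <= y -> 0 <= l ->
  l <= 1 - y + y ^ 2 / 2 - y ^ 3 / 6 + y ^ 4 / 24 - y ^ 5 / 120 + y ^ 6 / 720
       - y ^ 7 / 5040 ->
  1 - y + y ^ 2 / 2 - y ^ 3 / 6 + y ^ 4 / 24 - y ^ 5 / 120 + y ^ 6 / 720 <= u ->
  l ^ 16 <= exp (- (16 * y)) <= u ^ 16.
Proof.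
intros y_ge0 l_ge0 le_l le_u.
pose proof (exp_neg_taylor_bounds y y_ge0).
replace (exp (- (16 * y))) with (exp (- y) ^ 16).
- split; apply pow_incr; lra.
- rewrite <- exp_neg_mult_INR; do 2 f_equal; simpl; ring.
Qed.

(* Without the inner parentheses, the argument would parse as a negative
   literal, which is not syntactically the opposite of 2.9934. *)
Lemma exp_neg_29934 : 0.05011674 <= exp (- (2.9934)) <= 0.05011676.
Proof.
replace (- (2.9934)) with (- (16 * (2.9934 / 16))) by lra.
(* The two decimals enclose exp (- 2.9934 / 16) tightly enough for their 16th powers to lie within
   the stated bounds. *)
destruct (exp_neg_bounds (2.9934 / 16) 0.829371160 0.829371167); lra.
Qed.

Lemma exp_neg_299345 : 0.05011423 <= exp (- (2.99345)) <= 0.05011426.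
Proof.
replace (- (2.99345)) with (- (16 * (2.99345 / 16))) by lra.
destruct (exp_neg_bounds (2.99345 / 16) 0.829368568 0.829368576); lra.
Qed.

(** * Signs of the gap at 2.9934 and 2.99345 *)

Lemma pow_le_small q k : 0 <= q <= 0.0502 -> 0 <= q ^ (k + 6) <= / 10 ^ 7.
Proof.
intros q_bounds; split; [apply pow_le; lra |].
rewrite pow_add; apply Rle_trans with (1 ^ k * 0.0502 ^ 6).
- apply Rmult_le_compat; try (apply pow_le; lra); apply pow_incr; lra.
- rewrite pow1; lra.
Qed.

Lemma pow_enclosure l u q k : 0 <= l -> l <= q <= u -> l ^ k <= q ^ k <= u ^ k.
Proof. intros l_ge0 q_bounds; split; apply pow_incr; lra. Qed.

Ltac expand_gap_approx :=
  unfold gap_approx, remainder_integral;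
  repeat rewrite sum_Sn; rewrite sum_O;
  repeat change (@plus _ ?a ?b) with (Rplus a b);
  rewrite !exp_neg_mult_INR, !INR_IZR_INZ; simpl Z.of_nat.

(* From the sixth power on, the crude bound 10^-7 is precise enough. *)
Ltac enclose_powers q l u :=
  let rec enclose k :=
    match k with
    | O => idtac
    | S ?k' => pose proof (pow_enclosure l u q k ltac:(lra) ltac:(lra));
               enclose k'
    end in
  enclose 5%nat;
  let rec bound_small k :=
    match k with
    | O => idtac
    | S ?k' => pose proof (pow_le_small q k' ltac:(lra)); bound_small k'
    end in
  bound_small 25%nat; simpl Nat.add in *.

(** Index 29 means N = 30 geometric terms. With q = exp (- 2.9934) the bound is linear in q, q^2,
    ..., q^30, so enclosing each power leaves a problem of linear arithmetic. *)
Lemma gap_29934_neg : gap 2.9934 < 0.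
Proof.
apply Rle_lt_trans with (1 := gap_le_approx 29 2.9934 ltac:(lra)).
expand_gap_approx.
pose proof exp_neg_29934 as q_bounds.
generalize dependent (exp (- (2.9934))); intros q q_bounds.
enclose_powers q 0.05011674 0.05011676; lra.
Qed.

Lemma gap_299345_lt : gap 2.99345 < 5 / 10 ^ 5.
Proof.
apply Rle_lt_trans with (1 := gap_le_approx 29 2.99345 ltac:(lra)).
expand_gap_approx.
pose proof exp_neg_299345 as q_bounds.
generalize dependent (exp (- (2.99345))); intros q q_bounds.
enclose_powers q 0.05011423 0.05011426; lra.
Qed.

Lemma gap_299345_pos : 0 < gap 2.99345.
Proof.
apply Rlt_le_trans with (2 := gap_ge_approx 29 2.99345 ltac:(lra)).
expand_gap_approx.
pose proof exp_neg_299345 as q_bounds.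
generalize dependent (exp (- (2.99345))); intros q q_bounds.
enclose_powers q 0.05011423 0.05011426; lra.
Qed.

Lemma gap_zero_exists : exists zeta, 2.9934 < zeta < 2.99345 /\ gap zeta = 0.
Proof.
destruct (IVT gap 2.9934 2.99345) as [zeta [zeta_in gap_zeta]].
- intros x; apply continuity_pt_filterlim, (ex_derive_continuous gap).
  eexists; apply gap_derive.
- lra.
- apply gap_29934_neg.
- apply gap_299345_pos.
- exists zeta; split; [| easy].
  pose proof gap_29934_neg; pose proof gap_299345_pos.
  destruct zeta_in as [[| <-] [| ->]]; lra.
Qed.

(** * The displacements in the dimensionless variable *)

Lemma RInt_rescale (F : R -> R) (C b w : R) :
  ex_RInt F 0 (b * w) ->
  RInt (fun x => C * (b * F (b * x))) 0 w = C * RInt F 0 (b * w).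
Proof.
intros exF.
assert (exF' : ex_RInt F (b * 0 + 0) (b * w + 0))
  by now rewrite Rmult_0_r, !Rplus_0_r.
pose proof (ex_RInt_comp_lin (V := R_NormedModule) F b 0 0 w exF') as ex_comp.
pose proof (RInt_comp_lin (V := R_CompleteNormedModule) F b 0 0 w exF') as E.
rewrite Rmult_0_r, !Rplus_0_r in E; rewrite <- E.
etransitivity; [| exact (RInt_scal (V := R_CompleteNormedModule)
                          (fun x => scal b (F (b * x + 0))) 0 w C ex_comp)].
apply RInt_ext; intros x _; now rewrite Rplus_0_r.
Qed.

(** With [r = exp (- (y / 2))] the term is n r^n r^n, and n r^n <= 2 / y because exp (n y / 2) >= n
    y / 2. A geometric bound remains. *)
Lemma is_lim_seq_INR_mult_exp_neg y : 0 < y ->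
  is_lim_seq (fun n => INR n * exp (- y) ^ n) 0.
Proof.
intros y_gt0.
set (r := exp (- (y / 2))).
assert (r_bounds : 0 < r < 1).
{ split; [apply exp_pos | rewrite <- exp_0; apply exp_increasing; lra]. }
apply is_lim_seq_le_le with (fun _ => 0) (fun n => 2 / y * r ^ n).
- intros n; split.
  + apply Rmult_le_pos; [apply pos_INR | apply pow_le; left; apply exp_pos].
  + replace (exp (- y) ^ n) with (r ^ n * r ^ n).
    2:{ unfold r; rewrite <- Rpow_mult_distr, <- exp_plus; do 2 f_equal; field. }
    rewrite <- Rmult_assoc; apply Rmult_le_compat_r; [apply pow_le; lra |].
    unfold r; rewrite <- exp_neg_mult_INR, exp_Ropp.
    pose proof (exp_pos (INR n * (y / 2))).
    apply Rmult_le_reg_r with (exp (INR n * (y / 2))); [easy |].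
    rewrite Rmult_assoc, Rinv_l, Rmult_1_r by lra.
    apply Rmult_le_reg_l with (y / 2); [lra |].
    replace (y / 2 * (2 / y * exp (INR n * (y / 2))))
      with (exp (INR n * (y / 2))) by (field; lra).
    pose proof (exp_ineq1_le (INR n * (y / 2))); lra.
- apply is_lim_seq_const.
- replace (Finite 0) with (Rbar_mult (2 / y) 0)
    by (simpl; f_equal; ring).
  apply is_lim_seq_scal_l, is_lim_seq_geom; rewrite Rabs_pos_eq; lra.
Qed.

(* The partial sums telescope: up to the factor [c], the k-th term is
   [t k - t (S k)] with [t k = q ^ S k * (k + 3 / 2 + q / (1 - q))]. *)
Lemma thermal_series y c : 0 < y ->
  is_series (fun k => (1 - exp (- y)) * exp (- y) ^ S k * (INR (S k) + 1 / 2) * c)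
    ((/ (exp y - 1) + exp (- y) / 2) * c).
Proof.
intros y_gt0; apply is_series_scal_r.
pose proof (expm1_pos y y_gt0) as y_expm1.
assert (q_eq : exp (- y) * exp y = 1)
  by (rewrite <- exp_plus, Rplus_opp_l; apply exp_0).
assert (q_bounds : 0 < exp (- y) < 1).
{ split; [apply exp_pos | rewrite <- exp_0; apply exp_increasing; lra]. }
set (q := exp (- y)) in *.
replace (/ (exp y - 1)) with (q / (1 - q)).
2:{ replace q with (/ exp y) by (unfold q; now rewrite exp_Ropp).
    field; lra. }
set (t := fun k => q ^ S k * (INR k + 3 / 2 + q / (1 - q))).
assert (partial : forall n,
  sum_n (fun k => (1 - q) * q ^ S k * (INR (S k) + 1 / 2)) n = t 0%nat - t (S n)).
{ assert (telescope : forall k,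
    (1 - q) * q ^ S k * (INR (S k) + 1 / 2) = t k - t (S k)).
  { intros k; unfold t; rewrite S_INR; simpl; field; lra. }
  induction n as [| n IHn].
  - now rewrite sum_O.
  - rewrite sum_Sn, IHn, telescope; change (@plus _ ?a ?b) with (Rplus a b).
    apply (Rminus_diag_uniq (_ + _) (_ - _)); ring. }
(* The subtracted 0 is the limit of [t]. *)
replace (q / (1 - q) + q / 2) with (t 0%nat - 0)
  by (unfold t; simpl; field; lra).
apply (is_lim_seq_ext (fun n => t 0%nat - t (S n)) _ (t 0%nat - 0)).
{ intros n; symmetry; apply partial. }
apply is_lim_seq_minus'; [apply is_lim_seq_const |].
apply (is_lim_seq_incr_1 t).
apply is_lim_seq_ext with
  (fun n => q * (INR n * q ^ n) + q * (3 / 2 + q / (1 - q)) * q ^ n).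
{ intros n; unfold t; simpl; ring. }
replace (Finite 0) with (Finite (q * 0 + q * (3 / 2 + q / (1 - q)) * 0))
  by (f_equal; ring).
apply is_lim_seq_plus'.
- apply (is_lim_seq_scal_l _ q 0), is_lim_seq_INR_mult_exp_neg; easy.
- apply (is_lim_seq_scal_l _ (q * (3 / 2 + q / (1 - q))) 0).
  apply is_lim_seq_geom; rewrite Rabs_pos_eq; lra.
Qed.

(** Substitute x = b w with [b = beta kB T * hbar], which sends [omegaD] to [thetaD / T]. The factor
    w left by [g w / w] gives 1 / b, and dw gives another, whence b^2 in the denominator. *)
Lemma msd_zero_point_eq hbar kB m thetaD g A T :
  0 < hbar -> 0 < kB -> 0 < m -> 0 < thetaD -> 0 < T ->
  let omegaD := debye_frequency hbar kB thetaD in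
  (forall w, 0 < w <= omegaD -> g w = A * w ^ 2) ->
  msd_zero_point hbar kB m omegaD g T
  = hbar * A / (m * (beta kB T * hbar) ^ 2) * reduced_zero_point (thetaD / T).
Proof.
intros hbar_gt0 kB_gt0 m_gt0 thetaD_gt0 T_gt0 omegaD g_eq.
assert (omegaD_gt0 : 0 < omegaD)
  by (apply Rdiv_lt_0_compat; [apply Rmult_lt_0_compat |]; easy).
assert (b_gt0 : 0 < beta kB T * hbar).
{ apply Rmult_lt_0_compat; [apply Rinv_0_lt_compat, Rmult_lt_0_compat |]; easy. }
replace (thetaD / T) with (beta kB T * hbar * omegaD)
  by (unfold beta, omegaD, debye_frequency; field; lra).
unfold reduced_zero_point; rewrite <- RInt_rescale by apply zero_point_ex_RInt.
apply RInt_eq_on; [lra | intros w w_in].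
rewrite g_eq by lra.
generalize dependent (beta kB T * hbar); intros b; intros.
field; lra.
Qed.

Lemma msd_thermal_eq hbar kB m thetaD g A T :
  0 < hbar -> 0 < kB -> 0 < m -> 0 < thetaD -> 0 < T ->
  let omegaD := debye_frequency hbar kB thetaD in
  (forall w, 0 < w <= omegaD -> g w = A * w ^ 2) ->
  msd_thermal hbar kB m omegaD g T
  = hbar * A / (m * (beta kB T * hbar) ^ 2) * reduced_thermal (thetaD / T).
Proof.
intros hbar_gt0 kB_gt0 m_gt0 thetaD_gt0 T_gt0 omegaD g_eq.
assert (omegaD_gt0 : 0 < omegaD)
  by (apply Rdiv_lt_0_compat; [apply Rmult_lt_0_compat |]; easy).
assert (b_gt0 : 0 < beta kB T * hbar).
{ apply Rmult_lt_0_compat; [apply Rinv_0_lt_compat, Rmult_lt_0_compat |]; easy. }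
replace (thetaD / T) with (beta kB T * hbar * omegaD)
  by (unfold beta, omegaD, debye_frequency; field; lra).
unfold reduced_thermal; rewrite <- RInt_rescale
  by (apply thermal_ex_RInt, Rmult_le_pos; lra).
apply RInt_eq_on; [lra | intros w w_in].
rewrite g_eq by lra.
assert (bw_gt0 : 0 < beta kB T * hbar * w) by (apply Rmult_lt_0_compat; lra).
rewrite (Series_ext _ (fun k =>
  (1 - exp (- (beta kB T * hbar * w))) * exp (- (beta kB T * hbar * w)) ^ S k
  * (INR (S k) + 1 / 2) * (hbar / (m * w)))).
2:{ intros k; rewrite <- exp_neg_mult_INR; do 5 f_equal; ring. }
rewrite (is_series_unique _ _ (thermal_series _ _ bw_gt0)).
rewrite <- thermal_density_eq, planck_neq0 by lra.
pose proof (expm1_pos _ bw_gt0) as expm1_gt0.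
generalize dependent (beta kB T * hbar); intros b; intros.
field; lra.
Qed.

(** The factor [C] may depend on T; being positive, it leaves the sign and the zeros of the
    difference to [gap]. *)
Lemma msd_difference hbar kB m thetaD g T :
  0 < hbar -> 0 < kB -> 0 < m -> 0 < thetaD -> 0 < T ->
  is_debye_dos (debye_frequency hbar kB thetaD) g ->
  exists C : R, 0 < C /\
    msd_zero_point hbar kB m (debye_frequency hbar kB thetaD) g T -
    msd_thermal hbar kB m (debye_frequency hbar kB thetaD) g T =
    C * gap (thetaD / T).
Proof.
intros hbar_gt0 kB_gt0 m_gt0 thetaD_gt0 T_gt0 [A [A_gt0 [g_eq _]]].
exists (hbar * A / (m * (beta kB T * hbar) ^ 2)); split.
- apply Rdiv_lt_0_compat; [now apply Rmult_lt_0_compat |].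
  apply Rmult_lt_0_compat; [easy |].
  apply pow_lt, Rmult_lt_0_compat; [| easy].
  now apply Rinv_0_lt_compat, Rmult_lt_0_compat.
- rewrite (msd_zero_point_eq _ _ _ _ _ A), (msd_thermal_eq _ _ _ _ _ A) by easy.
  rewrite <- gap_eq; [ring |].
  left; now apply Rdiv_lt_0_compat.
Qed.

(** * The characteristic temperature *)

Theorem theorem2 :
  exists zeta : R,
    Rabs (zeta - 2.99345) < 5 / 10 ^ 5 /\
    Rabs (reduced_zero_point 2.99345 - reduced_thermal 2.99345) < 5 / 10 ^ 5 /\
    forall (hbar kB m thetaD : R) (g : R -> R) (T0 : R),
      0 < hbar -> 0 < kB -> 0 < m -> 0 < thetaD ->
      is_debye_dos (debye_frequency hbar kB thetaD) g ->
      (is_characteristic_temperature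
         hbar kB m (debye_frequency hbar kB thetaD) g T0
       <-> T0 = thetaD / zeta).
Proof.
destruct gap_zero_exists as [zeta [zeta_in gap_zeta]].
exists zeta; split; [| split].
(* The interval (2.9934, 2.99345) containing [zeta] has length exactly 5 / 10^5. *)
- apply Rabs_def1; lra.
- pose proof gap_299345_lt; pose proof gap_299345_pos.
  rewrite gap_eq by lra; apply Rabs_def1; lra.
- intros hbar kB m thetaD g T0 hbar_gt0 kB_gt0 m_gt0 thetaD_gt0 dos_g.
  assert (difference := fun T T_gt0 => msd_difference hbar kB m thetaD g T
    hbar_gt0 kB_gt0 m_gt0 thetaD_gt0 T_gt0 dos_g).
  split.
  + intros [T0_gt0 [msd_eq _]].
    destruct (difference T0 T0_gt0) as [C [C_gt0 E]].
    rewrite msd_eq, Rminus_diag in E.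
    assert (gap (thetaD / T0) = 0) as gap_T0
      by (destruct (Rmult_integral _ _ (eq_sym E)); lra).
    assert (z_gt0 : 0 < thetaD / T0) by now apply Rdiv_lt_0_compat.
    replace zeta with (thetaD / T0); [field; lra |].
    (* If the two positive zeros of [gap] differed, [gap] would be positive at the larger one. *)
    destruct (Rtotal_order (thetaD / T0) zeta) as [lt | [-> | gt]]; [| easy |].
    * pose proof (gap_pos_after_zero _ _ z_gt0 gap_T0 lt); lra.
    * assert (zeta_gt0 : 0 < zeta) by lra.
      pose proof (gap_pos_after_zero _ _ zeta_gt0 gap_zeta gt); lra.
  + intros ->.
    assert (T0_gt0 : 0 < thetaD / zeta) by (apply Rdiv_lt_0_compat; lra).
    split; [easy | split].
    * destruct (difference _ T0_gt0) as [C [_ E]].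
      replace (thetaD / (thetaD / zeta)) with zeta in E by (field; lra).
      rewrite gap_zeta in E; lra.
    * intros T [T_gt0 T_lt].
      destruct (difference T T_gt0) as [C [C_gt0 E]].
      (* Temperatures below [thetaD / zeta] correspond to arguments beyond [zeta], where [gap] is
         positive. *)
      assert (zeta < thetaD / T) as lt_zeta.
      { apply Rmult_lt_reg_r with (T / zeta).
        - apply Rdiv_lt_0_compat; lra.
        - replace (zeta * (T / zeta)) with T by (field; lra).
          replace (thetaD / T * (T / zeta)) with (thetaD / zeta) by (field; lra).
          easy. }
      assert (0 < C * gap (thetaD / T)).
      { apply Rmult_lt_0_compat; [easy |].
        apply gap_pos_after_zero with zeta; lra. }
      lra.
Qed.
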